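(* If $G$ is a graph of order $n$, minimum degree $\delta \ge 1$, and maximum degree $\Delta$, then \[ \gamma_e(G) \ge \frac{\delta n}{2(\Delta + \delta - 1)}. \]
   Context: All graphs are finite, simple and undirected. A matching is a set of pairwise vertex-disjoint edges; it is maximal if it is maximal with respect to inclusion. The edge domination number $\gamma_e(G)$ is the minimum cardinality of a maximal matching of $G$. *)

(* Defs.v *)
From mathcomp Require Import all_boot all_order all_algebra.

Set Implicit Arguments.
Unset Strict Implicit.
Unset Printing Implicit Defensive.

(* A finite simple graph is a symmetric irreflexive relation [e] on a finType. *)

Section Graph.
Variables (T : finType) (e : rel T).

Definition edges : {set {set T}} :=
  [set [set x; y] | x in T, y in T & e x y].

Definition degree (x : T) : nat := #|[set y | e x y]|.

Definition max_degree : nat := \max_(x : T) degree x.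

(* The default #|T| bounds every degree, so it does not affect the minimum as
   soon as there is a vertex; the null graph gets min_degree = 0. *)
Definition min_degree : nat := \big[minn/#|T|]_(x : T) degree x.

Definition matching (M : {set {set T}}) : bool :=
  (M \subset edges) && trivIset M.

Definition maximal_matching (M : {set {set T}}) : bool := maxset matching M.

Lemma maximal_matching_exists :
  exists k, [exists M : {set {set T}}, maximal_matching M && (#|M| == k)].
Proof.
have m0 : matching set0.
  rewrite /matching sub0set; apply/trivIsetP=> A B; by rewrite inE.
have [M maxM _] := maxset_exists m0.
by exists #|M|; apply/existsP; exists M; rewrite [maximal_matching M]maxM eqxx.
Qed.

Definition edge_domination_number : nat := ex_minn maximal_matching_exists.

End Graph.

(* Main.v *)
Require Import Defs.
From mathcomp Require Import all_boot all_order all_algebra.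
Import Order.TTheory GRing.Theory Num.Theory.
Local Open Scope ring_scope.

(** Let [M] be a maximal matching and [C] the set of vertices it covers, so
    that [#|C| = 2 * #|M|].  Count the edges between [C] and its complement:
    the complement is independent, so each of its vertices sends at least
    [min_degree] edges to [C]; each vertex of [C] has its partner in [C], so it
    sends at most [max_degree - 1] edges out. *)

Section Matchings.
Local Set Implicit Arguments.
Local Unset Strict Implicit.
Local Open Scope nat_scope.
Variables (T : finType) (e : rel T).
Implicit Types (x y : T) (B : {set T}) (M : {set {set T}}).

Lemma edgesP B :
  reflect (exists x y, e x y /\ B = [set x; y]) (B \in edges e).
Proof.
apply: (iffP imset2P) => [[x y _]|[x [y [exy ->]]]].
  by rewrite inE /= => exy ->; exists x, y.
by exists x y; rewrite // inE.
Qed.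

(** The default [#|T|] is not neutral for [minn], so [x] is reached by induction on the enumeration
    of the vertices. *)
Lemma min_degree_le x : min_degree e <= degree e x.
Proof.
rewrite /min_degree; elim: (index_enum T) (mem_index_enum x) => // y r IHr.
rewrite big_cons geq_min inE => /predU1P[-> | /IHr ->]; last exact: orbT.
by rewrite leqnn.
Qed.

Lemma max_degree_ge x : degree e x <= max_degree e.
Proof. exact: leq_bigmax. Qed.

Hypotheses (e_sym : symmetric e) (e_irrefl : irreflexive e).

Lemma card_edge B : B \in edges e -> #|B| = 2.
Proof.
case/edgesP=> x [y [exy ->]]; rewrite cards2.
by have [eq_xy|//] := eqVneq; rewrite eq_xy e_irrefl in exy.
Qed.

Lemma card_cover_matching M : matching e M -> #|cover M| = 2 * #|M|.
Proof.
case/andP=> /subsetP sub_M_edges /eqP <-.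
rewrite (eq_bigr (fun=> 2)) => [|B /sub_M_edges /card_edge //].
by rewrite sum_nat_const mulnC.
Qed.

Lemma matching_partner M x :
  matching e M -> x \in cover M -> exists2 y, y \in cover M & e x y.
Proof.
case/andP=> /subsetP sub_M_edges _ /bigcupP[B MB].
have /edgesP[u [v [euv defB]]] := sub_M_edges _ MB.
rewrite defB in MB *; case/set2P=> ->.
  by exists v => //; apply/bigcupP; exists [set u; v]; rewrite ?set22.
by exists u; rewrite 1?e_sym //; apply/bigcupP; exists [set u; v]; rewrite ?set21.
Qed.

(** Otherwise [[set x; y]] would be disjoint from every edge of [M], and adding it would give a
    larger matching. *)
Lemma maximal_matching_uncovered M x y :
  maximal_matching e M -> x \notin cover M -> y \notin cover M -> ~~ e x y.
Proof.
case/maxsetP=> /andP[sub_M_edges trivM] maxM xC yC; apply/negP=> exy.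
have xyE : [set x; y] \in edges e by apply/edgesP; exists x, y.
have disj B : B \in M -> [disjoint [set x; y] & B].
  move=> MB; have sBC : B \subset cover M by apply: bigcup_sup.
  rewrite -setI_eq0; apply/eqP/setP=> z; rewrite !inE.
  by apply/negP=> /andP[/orP[]/eqP-> /(subsetP sBC)]; apply/negP.
have matchM' : matching e ([set x; y] |: M).
  rewrite /matching subUset sub1set xyE sub_M_edges /=.
  apply/trivIsetP=> A B /setU1P[-> | MA] /setU1P[-> | MB]; rewrite ?eqxx //.
  - by move=> _; apply: disj.
  - by move=> _; rewrite disjoint_sym; apply: disj.
  by move/trivIsetP: trivM; apply.
have Mxy : [set x; y] \in M by rewrite -(maxM _ matchM') ?subsetUr ?setU11.
by case/bigcupP: xC; exists [set x; y]; rewrite ?set21.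
Qed.

(** The term [2 * #|M|] stands on the left so that the factor Δ + δ - 1 needs no truncated
    subtraction. *)
Lemma maximal_matching_card_ge M : maximal_matching e M ->
  min_degree e * #|T| + 2 * #|M| <= (max_degree e + min_degree e) * (2 * #|M|).
Proof.
move=> maxM; have matchM : matching e M by case/maxsetP: maxM.
rewrite -(card_cover_matching matchM) -(cardsC (cover M)).
set C := cover M.
(* All neighbours of an uncovered vertex lie in [C], so its whole degree is counted. *)
have out_lb : min_degree e * #|~: C| <= \sum_(x in ~: C) \sum_(y in C) e x y.
  rewrite mulnC -sum_nat_const; apply: leq_sum => x; rewrite inE => xC.
  apply: leq_trans (min_degree_le x) _.
  rewrite /degree -sum1_card big_mkcond [leqRHS]big_mkcond /=.
  apply: leq_sum => y _; rewrite inE; case: ifP => // exy.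
  case: ifP => // yC; rewrite ?exy //.
  by have := maximal_matching_uncovered maxM xC (negbT yC); rewrite exy.
have in_ub : \sum_(y in C) \sum_(x in ~: C) e x y + #|C| <= max_degree e * #|C|.
  rewrite mulnC -sum_nat_const -sum1_card -big_split /=.
  apply: leq_sum => y yC; apply: leq_trans (max_degree_ge y).
  have [z zC eyz] := matching_partner matchM yC.
  (* The partner [z] of [y] is split off from the neighbours of [y] to pay for the unit that [y]
     contributes to [#|C|]; as [z] is in [C], no edge leaving [C] is lost. *)
  rewrite /degree -sum1_card [leqRHS](bigD1 z) ?inE //= addnC leq_add2l.
  rewrite big_mkcond [leqRHS]big_mkcond /=; apply: leq_sum => x _.
  rewrite !inE e_sym; case: ifP => // xC; case: (e y x) => //=.
  by case: eqVneq xC => // ->; rewrite zC.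
(* Both bounds now concern the same count of edges between [C] and [~: C]; the part
   [min_degree e * #|C|] of the goal cancels. *)
rewrite exchange_big /= in out_lb.
rewrite mulnDr mulnDl -addnA addnC leq_add2r.
by apply: leq_trans in_ub; rewrite leq_add2r.
Qed.

Lemma edge_domination_numberP :
  exists2 M, maximal_matching e M & #|M| = edge_domination_number e.
Proof.
rewrite /edge_domination_number; case: ex_minnP => k /existsP[M].
by case/andP=> maxM /eqP cardM _; exists M.
Qed.

End Matchings.

Theorem theorem4 (T : finType) (e : rel T)
    (e_sym : symmetric e) (e_irrefl : irreflexive e)
    (min_degree_ge1 : (1 <= min_degree e)%N) :
  (min_degree e)%:R * #|T|%:R
    / (2%:R * ((max_degree e)%:R + (min_degree e)%:R - 1))
  <= (edge_domination_number e)%:R :> rat.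
Proof.
have [M maxM <-] := edge_domination_numberP e.
have := maximal_matching_card_ge e_sym e_irrefl maxM.
(* Since δ is at least 1, its natural-number predecessor agrees with the rational subtraction. *)
have -> : (max_degree e)%:R + (min_degree e)%:R - 1
          = (max_degree e + (min_degree e).-1)%:R :> rat.
  by rewrite -{1}(prednK min_degree_ge1) -natr1 addrA addrK natrD.
rewrite -{2}(prednK min_degree_ge1) addnS mulSn addnC leq_add2l => bound.
rewrite -!natrM; set d := (_ + _)%N in bound *.
(* If [d] is 0, the quotient is 0 because the inverse of 0 is 0 by convention. *)
have [->|d_gt0] := posnP d; first by rewrite muln0 invr0 mulr0.
rewrite ler_pdivrMr ?ltr0n ?muln_gt0 //.
by rewrite -natrM ler_nat [(#|M| * _)%N]mulnC -mulnA mulnCA.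
Qed.
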